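(* If the underlying graph of a configuration of $n$ points contains a $k$-clique, then $n\ge \lfloor k^2/2\rfloor$. Consequently, the largest clique in an underlying graph with $n$ vertices has at most $\sqrt{2n}+1$ vertices.
   Context: A configuration of $n$ points ($n$ even) is a set of $n$ points in $\mathbb{R}^2$ in general position (no three collinear). A halving line of the configuration is a line through two of the points such that exactly $(n-2)/2$ of the remaining $n-2$ points lie on each side of it. The underlying graph of the configuration is the graph whose vertices are the $n$ points, two vertices being adjacent if and only if the line through the corresponding two points is a halving line. A $k$-clique is a set of $k$ pairwise adjacent vertices. *)

(* Defs.v *)
From HB Require Import structures.
From mathcomp Require Import all_boot all_order all_algebra.
From mathcomp Require Import reals.
From mathcomp Require Import ring.

Set Implicit Arguments.
Unset Strict Implicit.
Unset Printing Implicit Defensive.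

Import Order.TTheory GRing.Theory Num.Theory.
Local Open Scope ring_scope.

Definition on_line (R : realType) (a b p : 'rV[R]_2) : Prop :=
  exists t : R, p = a + t *: (b - a).

Definition collinear (R : realType) (p q r : 'rV[R]_2) : Prop :=
  exists a b : 'rV[R]_2,
    [/\ a != b, on_line a b p, on_line a b q & on_line a b r].

(* The cross product (b - a) x (p - a).  For a != b it is an affine form in p
   vanishing exactly on the line through a and b (lemma line_form_eq0), so the
   two sides of that line are the open half-planes where it is > 0 and < 0. *)
Definition line_form (R : realType) (a b p : 'rV[R]_2) : R :=
  (b 0 0 - a 0 0) * (p 0 1 - a 0 1) - (b 0 1 - a 0 1) * (p 0 0 - a 0 0).

Lemma line_form_eq0 (R : realType) (a b p : 'rV[R]_2) :
  a != b -> line_form a b p = 0 <-> on_line a b p.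
Proof.
move=> ab; split; last first.
  by case=> t ->; rewrite /line_form !mxE; ring.
rewrite /line_form => /eqP; rewrite subr_eq0 => /eqP H.
have E (u v : 'rV[R]_2) : u 0 0 = v 0 0 -> u 0 1 = v 0 1 -> u = v.
  move=> h0 h1; apply/rowP => i.
  case: i => [[|[|//]] hi].
    by rewrite (_ : Ordinal hi = 0) //; apply/val_inj.
  by rewrite (_ : Ordinal hi = 1) //; apply/val_inj.
have [x0|x0] := eqVneq (b 0 0 - a 0 0) 0.
  have y0 : b 0 1 - a 0 1 != 0.
    apply: contraNneq ab => y0; apply/eqP/esym/E; apply/eqP;
      by rewrite -subr_eq0 ?x0 ?y0.
  exists ((p 0 1 - a 0 1) / (b 0 1 - a 0 1)); apply: E; rewrite !mxE.
    move/eqP: H; rewrite x0 mul0r eq_sym mulf_eq0 (negPf y0) subr_eq0 /=.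
    by move/eqP ->; rewrite mulr0 addr0.
  by rewrite divfK // addrC subrK.
exists ((p 0 0 - a 0 0) / (b 0 0 - a 0 0)); apply: E; rewrite !mxE.
  by rewrite divfK // addrC subrK.
rewrite mulrAC [_ * (b 0 1 - a 0 1)]mulrC -H mulrAC divff // mul1r.
by rewrite addrC subrK.
Qed.

(* A set of n points is presented as an injective family indexed by 'I_n. *)
Definition configuration (R : realType) (n : nat) (P : 'I_n -> 'rV[R]_2) : Prop :=
  injective P /\
  forall i j k : 'I_n, i != j -> j != k -> i != k ->
    ~ collinear (P i) (P j) (P k).

(* P i and P j lie on the line, where line_form vanishes, so each of the two
   sets only contains points among the n - 2 remaining ones. *)
Definition halving (R : realType) (n : nat) (P : 'I_n -> 'rV[R]_2)
    (i j : 'I_n) : bool :=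
  (#|[set k | (0 < line_form (P i) (P j) (P k))%R]| == (n - 2) %/ 2)%N &&
  (#|[set k | (line_form (P i) (P j) (P k) < 0)%R]| == (n - 2) %/ 2)%N.

Definition underlying_graph (R : realType) (n : nat) (P : 'I_n -> 'rV[R]_2) :
    rel 'I_n :=
  fun i j => (i != j) && halving P i j.

Definition is_clique (T : finType) (e : rel T) (S : {set T}) : bool :=
  [forall x in S, forall y in S, (x != y) ==> e x y].

Definition clique_number (T : finType) (e : rel T) : nat :=
  (\max_(S : {set T} | is_clique e S) #|S|)%N.

(* Main.v *)
Require Import Defs.
From HB Require Import structures.
From mathcomp Require Import all_boot all_order all_algebra.
From mathcomp Require Import reals.
From mathcomp Require Import zify ring.

Set Implicit Arguments.
Unset Strict Implicit.
Unset Printing Implicit Defensive.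

Import Order.TTheory GRing.Theory Num.Theory.
Local Open Scope ring_scope.

(** Every line missing the points crosses at most n/2 halving segments (the
    Lovasz lemma), while a line splitting a k-clique as evenly as possible
    crosses at least floor(k/2) * ceil(k/2) of them; hence
    floor(k^2/2) = 2 floor(k/2) ceil(k/2) <= n.

    The Lovasz lemma is local.  Fix a direction that no line through two of the
    points follows, call it vertical, and rotate a line about a point p
    through a half-turn, starting from the vertical.  The difference between
    the numbers of points on its two sides is odd and changes by 2 whenever the
    line meets a point, upwards for a point to the right of p and downwards for
    a point to the left; the line is halving exactly when the difference changes
    sign.  Sign changes alternate, so among the halving segments at p those going
    right and those going left differ in number by at most one
    ([local_balance]).  Summing over the points to the left of a vertical line,
    the segments joining two of these points cancel and those crossing the line
    remain, so there are at most as many crossings as points on that side; the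
    same holds for the other side ([crossing_halving_le]).

    The rotation is encoded by the slopes of the other points seen from p: the
    line meets them in increasing order of slope, and the count becomes a walk
    with steps 1 and -1 whose crossings of a level are counted with sign
    ([net_crossings]).  The coordinates are sheared beforehand so that no two
    points have the same abscissa ([shear_separates]). *)

(** * Signed level crossings of a walk *)

(** Seen in increasing order of [s], the steps [eps] form a walk from 0; the
    summand of [j] is nonzero when step [j] crosses the level [t / 2], which the
    walk cannot hit as [t] is odd.  Consecutive crossings have opposite signs, so
    that only the two ends of the walk matter. *)
Lemma net_crossings (R : realDomainType) (T : finType) (s : T -> R)
    (eps : T -> int) (t : int) (A : {set T}) :
  {in A &, injective s} -> {in A, forall i, eps i = 1 \/ eps i = -1} ->
  (exists u : int, t = 2 * u + 1) ->
  \sum_(j in A) eps j *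
     (2 * (\sum_(i in A | s i < s j) eps i) + eps j == t)%R%:R
  = (t < 2 * \sum_(i in A) eps i)%R%:R - (t < 0)%R%:R :> int.
Proof.
move=> + + [u tE].
have [m] := ubnP #|A|; elim: m A => // m IH A Am sinj epsP.
have [->|[x xA]] := set_0Vmem A; first by rewrite !big_set0 mulr0 subrr.
have [z zA zmax] := Order.TotalTheory.arg_maxP s xA.
have {}zA : z \in A := zA.
have subA : {subset A :\ z <= A} by move=> i; rewrite inE => /andP[].
have ltz i : i \in A :\ z -> s i < s z.
  rewrite !inE => /andP[iz iA]; rewrite lt_neqAle (zmax i iA : s i <= s z) andbT.
  by apply: contra iz => /eqP/sinj ->.
have {}IH := IH (A :\ z).
rewrite (big_setD1 z) //= [\sum_(i in A) _](big_setD1 z) //=.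
have -> : \sum_(i in A | s i < s z) eps i = \sum_(i in A :\ z) eps i.
  apply: eq_bigl => i; rewrite !inE.
  have [->|iz] /= := eqVneq i z; first by rewrite ltxx andbF.
  have [iA|//] := boolP (i \in A); rewrite ltz //.
  by rewrite !inE iz iA.
have E j : j \in A :\ z ->
    \sum_(i in A | s i < s j) eps i = \sum_(i in A :\ z | s i < s j) eps i.
  move=> jA; apply: eq_bigl => i; rewrite !inE.
  have [->|//] := eqVneq i z.
  by rewrite (lt_gtF (ltz _ jA)) !andbF.
under eq_bigr => j jA do rewrite E //.
rewrite IH; last 3 first.
- by move: Am; rewrite (cardsD1 z A) zA; lia.
- by move=> i j /subA iA /subA jA; apply: sinj.
- by move=> i /subA; apply: epsP.
move: (\sum_(i in A :\ z) eps i) => W.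
case: (epsP z zA) => ->; lia.
Qed.

(** * Halving segments at one point *)

Lemma line_formC (R : realType) (a b p : 'rV[R]_2) :
  line_form b a p = - line_form a b p.
Proof. by rewrite /line_form; ring. Qed.

Lemma underlying_graph_sym (R : realType) n (P : 'I_n -> 'rV[R]_2) :
  symmetric (underlying_graph P).
Proof.
move=> i j; rewrite /underlying_graph eq_sym; congr (_ && _).
rewrite /halving andbC; congr (_ && _); congr (#|pred_of_set _| == _);
  by apply/setP => k; rewrite !inE line_formC ?oppr_gt0 ?oppr_lt0.
Qed.

Lemma line_form_neq0 (R : realType) n (P : 'I_n -> 'rV[R]_2) i j k :
  configuration P -> i != j -> j != k -> i != k ->
  line_form (P i) (P j) (P k) != 0.
Proof.
move=> [Pinj gp] ij jk ik; apply/eqP => D0.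
have Pij : P i != P j by rewrite (inj_eq Pinj).
apply: (gp i j k) => //; exists (P i), (P j); split=> //.
- by exists 0; rewrite scale0r addr0.
- by exists 1; rewrite scale1r addrC subrK.
- exact/line_form_eq0.
Qed.

(** The side counts of a line through two points always sum to [n - 2], so the
    line is halving as soon as they are equal, that is, as soon as the signs of
    the line form add up to 0. *)
Lemma halving_sum_sgz (R : realType) n (P : 'I_n -> 'rV[R]_2) i j :
  ~~ odd n -> configuration P -> i != j ->
  halving P i j = (\sum_k sgz (line_form (P i) (P j) (P k)) == 0).
Proof.
move=> ev conf ij; rewrite /halving.
set D := fun k => line_form (P i) (P j) (P k).
set p := #|_|; set q := #|_|.
have -> : \sum_k sgz (D k) = p%:R - q%:R.
  rewrite /p /q -!sum1_card !natr_sum.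
  rewrite [X in _ = X - _]big_mkcond [X in _ - X]big_mkcond -sumrB /=.
  apply: eq_bigr => k _; rewrite !inE -/(D k).
  by case: sgzP; rewrite ?subr0 ?sub0r.
have pq : (p + q + 2 = n)%N.
  have Dz k : (D k != 0) = (k \notin [set i; j]).
    rewrite !inE; apply/idP/idP.
      by apply: contra => /orP[]/eqP ->; rewrite /D /line_form; apply/eqP; ring.
    rewrite negb_or => /andP[ki kj].
    by apply: line_form_neq0; rewrite // eq_sym.
  rewrite -[RHS]card_ord -(cardC [set i; j]) cards2 ij addnC; congr addn.
  rewrite -cardUI [X in (_ + X)%N](_ : _ = 0)%N ?addn0; last first.
    by apply: eq_card0 => k; rewrite !inE -/(D k); apply/negP; case: ltgtP.
  apply: eq_card => k; rewrite !inE -/(D k); move: (Dz k); rewrite !inE => <-.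
  by case: ltgtP.
by apply/idP/idP; lia.
Qed.

(** * Shearing *)

(** The abscissa after a horizontal shear.  The ordinate is unchanged, and so is
    the line form, being a signed area. *)
Definition shear (R : realType) n (P : 'I_n -> 'rV[R]_2) (c : R) i : R :=
  P i 0 0 + c * P i 0 1.

(** Two points with distinct ordinates are merged by a single value of [c], so
    only finitely many values are excluded. *)
Lemma shear_separates (R : realType) n (P : 'I_n -> 'rV[R]_2) :
  injective P -> exists c, injective (shear P c).
Proof.
move=> Pinj.
pose bad (u : 'I_n * 'I_n) : R :=
  - (P u.1 0 0 - P u.2 0 0) / (P u.1 0 1 - P u.2 0 1).
(* When the ordinates agree, [bad] is 0 by division by 0, and the abscissas
   differ before and after the shear. *)
exists (1 + \sum_u `|bad u|) => i j /eqP.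
set c := 1 + _; rewrite -subr_eq0 /shear => /eqP E; apply: Pinj.
have cbad : bad (i, j) < c.
  rewrite /c (bigD1 (i, j)) //= addrA.
  apply: ltr_wpDr; first exact: sumr_ge0.
  by apply: le_lt_trans (ler_norm _) _; rewrite ltrDr.
have {E} E : c * (P i 0 1 - P j 0 1) = - (P i 0 0 - P j 0 0).
  by rewrite -[RHS]addr0 -E; ring.
have y0 : P i 0 1 - P j 0 1 = 0.
  apply/eqP; apply: contraTT cbad => y0.
  by rewrite /bad /= -E mulfK // ltxx.
move: E; rewrite y0 mulr0 => /esym/eqP; rewrite oppr_eq0 subr_eq0 => /eqP x0.
apply/rowP => k; move/eqP: y0; rewrite subr_eq0 => /eqP y0.
case: k => [[|[|//]] hk].
  by rewrite (_ : Ordinal hk = 0) //; apply/val_inj.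
by rewrite (_ : Ordinal hk = 1) //; apply/val_inj.
Qed.

Definition slope (R : realType) n (P : 'I_n -> 'rV[R]_2) c p i : R :=
  (P i 0 1 - P p 0 1) / (shear P c i - shear P c p).

Lemma line_form_slope (R : realType) n (P : 'I_n -> 'rV[R]_2) c p j k :
  injective (shear P c) -> j != p -> k != p ->
  line_form (P p) (P j) (P k)
  = (shear P c j - shear P c p) * (shear P c k - shear P c p)
    * (slope P c p k - slope P c p j).
Proof.
move=> Xinj; rewrite -!(inj_eq Xinj) -(subr_eq0 (shear _ _ j)).
rewrite -(subr_eq0 (shear _ _ k)) /slope /line_form /shear => jp kp.
by field; rewrite jp kp.
Qed.

Lemma slope_inj (R : realType) n (P : 'I_n -> 'rV[R]_2) c p :
  configuration P -> injective (shear P c) ->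
  {in [set~ p] &, injective (slope P c p)}.
Proof.
move=> conf Xinj j k; rewrite !inE => jp kp E.
apply/eqP/negPn/negP => jk.
have /eqP[] := line_form_neq0 (i := p) (j := j) (k := k) conf
  ltac:(by rewrite eq_sym) jk ltac:(by rewrite eq_sym).
by rewrite (line_form_slope Xinj jp kp) E subrr mulr0.
Qed.

(** * Crossings of a vertical line *)

(** The segment from [p] to [j] is halving exactly when the walk with steps
    1 or -1 (right or left of [p]), taken in increasing order of slope from [p],
    crosses at step [j] the half [t / 2] of its final value [t].  As [t] is odd,
    0 and [t] lie on opposite sides of [t / 2], so that [net_crossings] gives 1
    or -1. *)
Lemma local_balance (R : realType) n (P : 'I_n -> 'rV[R]_2) c p :
  ~~ odd n -> configuration P -> injective (shear P c) ->
  `|\sum_j sgz (shear P c j - shear P c p) * (underlying_graph P p j)%:R|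
    <= 1 :> int.
Proof.
move=> ev conf Xinj.
pose X := shear P c; pose s := slope P c p; pose eps i := sgz (X i - X p).
pose A := [set~ p]; pose t := \sum_(i in A) eps i.
have epsP : {in A, forall i, eps i = 1 \/ eps i = -1}.
  move=> i; rewrite !inE -(inj_eq Xinj) -subr_eq0 -/X /eps.
  by case: sgzP; rewrite ?eqxx //; auto.
(* [t] has the parity of its number of steps, [n - 1]. *)
have tE : exists u : int, t = 2 * u + 1.
  have [u E] : exists u : int, \sum_(i in A) eps i = 2 * u + #|A|%:R.
    exists (- \sum_(i in A | eps i == -1) 1).
    rewrite -sum1_card natr_sum big_mkcondr /= mulrN mulr_sumr -sumrN -big_split.
    by apply: eq_bigr => i iA; case: (epsP i iA) => ->.
  have cA : (#|A| = n.-1)%N by rewrite cardsC1 card_ord.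
  have n0 : (0 < n)%N := leq_ltn_trans (leq0n _) (ltn_ord p).
  by exists (u + (n.-1)./2%:R); rewrite /t E cA; lia.
have := net_crossings (slope_inj (p := p) conf Xinj) epsP tE.
have -> : \sum_j sgz (shear P c j - shear P c p) * (underlying_graph P p j)%:R
   = \sum_(j in A) eps j *
     (2 * (\sum_(i in A | s i < s j) eps i) + eps j == t)%R%:R.
  rewrite [LHS](bigD1 p) //= subrr sgz0 mul0r add0r.
  apply: eq_big => [j|j jp]; first by rewrite !inE.
  congr (_ * (nat_of_bool _)%:R).
  rewrite /underlying_graph [p == j]eq_sym jp halving_sum_sgz 1?eq_sym //=.
  have jA : j \in A by rewrite !inE.
  (* A point after [j] in slope is on the side given by [eps j] times its own
     step, and a point before [j] on the opposite side. *)
  have -> : \sum_k sgz (line_form (P p) (P j) (P k))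
     = eps j * (t - eps j - 2 * \sum_(i in A | s i < s j) eps i).
    have -> : t - eps j = \sum_(i in A | i != j) eps i.
      by rewrite /t (bigD1 j) //= addrAC subrr add0r.
    rewrite big_mkcondr [X in _ - 2 * X]big_mkcondr mulr_sumr -sumrB mulr_sumr.
    rewrite (bigD1 p) //= (_ : line_form _ _ _ = 0) ?sgz0 ?add0r; last first.
      by rewrite /line_form; ring.
    apply: eq_big => [k|k kp]; first by rewrite !inE.
    rewrite (line_form_slope Xinj jp kp) !sgzM -mulrA; congr (_ * _).
    rewrite -/(eps k) -/s.
    have [->|kj] := eqVneq k j; first by rewrite subrr sgz0 ltxx !mulr0.
    have kA : k \in A by rewrite !inE.
    have skj : s k != s j.
      by apply: contra kj => /eqP/(slope_inj conf Xinj kA jA) ->.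
    by case: (ltgtP (s k) (s j)) skj => // lt _;
      [rewrite ltr0_sgz ?subr_lt0 | rewrite gtr0_sgz ?subr_gt0] => //; ring.
  move: (\sum_(i in A | _) _) => before.
  by case: (epsP j jA) => ->; apply/idP/idP; lia.
by move=> ->; rewrite -/A -/eps -/t; lia.
Qed.

(** Summing [local_balance] over [L], the halving segments inside [L] cancel,
    as each is seen once as a right segment and once as a left one. *)
Lemma crossing_halving_le (R : realType) n (P : 'I_n -> 'rV[R]_2) c
    (L : {set 'I_n}) :
  ~~ odd n -> configuration P -> injective (shear P c) ->
  {in L & ~: L, forall i j, shear P c i < shear P c j} ->
  (2 * \sum_(i in L) \sum_(j in ~: L) underlying_graph P i j <= n)%N.
Proof.
move=> ev conf Xinj Llt.
pose g i j : int := sgz (shear P c j - shear P c i) * (underlying_graph P i j)%:R.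
have gC i j : g i j = - g j i.
  by rewrite /g underlying_graph_sym -opprB sgzN mulNr.
have cut (B : {set 'I_n}) : `|\sum_(i in B) \sum_(j in ~: B) g i j| <= #|B|%:R.
  have -> : \sum_(i in B) \sum_(j in ~: B) g i j = \sum_(i in B) \sum_j g i j.
    have inner0 : \sum_(i in B) \sum_(j in B) g i j = 0.
      have : \sum_(i in B) \sum_(j in B) g i j
           = - \sum_(i in B) \sum_(j in B) g i j.
        rewrite {1}exchange_big /= -sumrN; apply: eq_bigr => i _.
        by rewrite -sumrN; apply: eq_bigr => j _; apply: gC.
      lia.
    rewrite -[LHS]add0r -{1}inner0 -big_split /=; apply: eq_bigr => i _.
    rewrite [RHS](bigID (mem B)) /=; congr (_ + _).
    by apply: eq_bigl => j; rewrite inE.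
  apply: le_trans (ler_norm_sum _ _ _) _.
  rewrite -sum1_card natr_sum; apply: ler_sum => i _.
  exact: local_balance.
have E : \sum_(i in L) \sum_(j in ~: L) g i j
   = (\sum_(i in L) \sum_(j in ~: L) underlying_graph P i j)%N%:R.
  rewrite natr_sum; apply: eq_bigr => i iL; rewrite natr_sum.
  apply: eq_bigr => j jL.
  by rewrite /g gtr0_sgz ?mul1r // subr_gt0 Llt.
have EC : \sum_(i in ~: L) \sum_(j in L) g i j
   = - \sum_(i in L) \sum_(j in ~: L) g i j.
  rewrite exchange_big -sumrN; apply: eq_bigr => i _.
  by rewrite -sumrN; apply: eq_bigr => j _; apply: gC.
have := cut L; have := cut (~: L); rewrite setCK EC E.
move: (\sum_(i in L) _)%N => crossings.
by have := cardsC L; rewrite card_ord; lia.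
Qed.

(** * Cutting a clique in two *)

(** A vertical line swept from left to right meets the points of [S] one at a
    time. *)
Lemma halfplane_split (R : realDomainType) (T : finType) (X : T -> R)
    (S : {set T}) m :
  injective X -> (m <= #|S|)%N ->
  exists2 L : {set T}, {in L & ~: L, forall i j, X i < X j} & #|L :&: S| = m.
Proof.
move=> Xinj; elim: m => [|m IH] mS.
  by exists set0; [move=> i j; rewrite inE | rewrite set0I cards0].
have [L Llt Lm] := IH (ltnW mS).
have /set0Pn[y yS] : S :\: L != set0.
  by rewrite -card_gt0 cardsD setIC; lia.
have [x xS xmin] := Order.TotalTheory.arg_minP X yS.
have {}xS : x \in S :\: L := xS.
move: (xS); rewrite inE => /andP[xL xinS].
exists (L :|: [set i | X i <= X x]).
  move=> i j; rewrite !inE negb_or -ltNge => iL /andP[jL xj].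
  by case/orP: iL => [iL|/le_lt_trans -> //]; apply: Llt; rewrite ?inE.
have -> : (L :|: [set i | X i <= X x]) :&: S = x |: (L :&: S).
  apply/setP => i; rewrite !inE.
  have [->|ix] /= := eqVneq i x; first by rewrite lexx orbT.
  have [//|iL] /= := boolP (i \in L).
  have [iS|] := boolP (i \in S); rewrite ?andbF // andbT.
  have xi : X x <= X i by apply: (xmin i); rewrite -[_ i]/(i \in S :\: L) inE iL.
  by apply: contraNF ix => ile; apply/eqP/Xinj/le_anti; rewrite ile xi.
by rewrite cardsU1 inE (negPf xL) Lm.
Qed.

Lemma clique_card_le (R : realType) n (P : 'I_n -> 'rV[R]_2) (S : {set 'I_n}) :
  ~~ odd n -> configuration P -> is_clique (underlying_graph P) S ->
  (#|S| ^ 2 %/ 2 <= n)%N.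
Proof.
move=> ev conf /forall_inP cl.
have [c Xinj] := shear_separates (proj1 conf).
have [L Llt Lk] := halfplane_split (m := #|S| %/ 2) Xinj (leq_div _ _).
apply: leq_trans (crossing_halving_le ev conf Xinj Llt).
have -> : (#|S| ^ 2 %/ 2 = 2 * (#|L :&: S| * #|S :\: L|))%N.
  by rewrite cardsD [S :&: L]setIC Lk; nia.
rewrite leq_mul2l /= -sum_nat_const.
rewrite [X in (_ <= X)%N](big_setID S) /=; apply: leq_trans (leq_addr _ _).
apply: leq_sum => i; rewrite inE => /andP[iL iS].
rewrite [X in (_ <= X)%N](big_setID S) /=; apply: leq_trans (leq_addr _ _).
rewrite -sum1_card setDE setIC; apply: leq_sum => j; rewrite !inE => /andP[jL jS].
have /forall_inP/(_ j jS)/implyP -> // := cl i iS.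
by apply: contraNneq jL => <-.
Qed.

Theorem corollary6p14 (R : realType) (n : nat) (P : 'I_n -> 'rV[R]_2)
    (n_even : ~~ odd n) (confP : configuration P) :
  (forall k : nat,
     (exists2 S : {set 'I_n}, is_clique (underlying_graph P) S & #|S| = k) ->
     (k ^ 2 %/ 2 <= n)%N) /\
  (clique_number (underlying_graph P))%:R <= Num.sqrt (2 * n%:R : R) + 1.
Proof.
split=> [k [S clS <-]|]; first exact: (clique_card_le n_even confP clS).
have : (clique_number (underlying_graph P) ^ 2 %/ 2 <= n)%N.
  apply: (big_ind (fun k => (k ^ 2 %/ 2 <= n)%N)) => [//|k l kn ln|S clS].
    by rewrite /maxn; case: ifP.
  exact: (clique_card_le n_even confP clS).
move: (clique_number _) => k kn.
have [->|k0] := posnP k; first by apply: addr_ge0; rewrite ?sqrtr_ge0 ?ler01.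
(* k^2 <= 2 n + 1 gives (k - 1)^2 <= 2 n once k is positive. *)
have k1 : ((k.-1 ^ 2)%N%:R <= 2 * n%:R :> R).
  by rewrite -natrM ler_nat; nia.
rewrite -(prednK k0) -natr1 lerD2r.
by rewrite -[leLHS]ger0_norm ?ler0n // -sqrtr_sqr ler_wsqrtr // -natrX.
Qed.
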